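(* Let $\mathbf x=(x_1,\ldots,x_7)\in\mathbb C^7$. Then $\mathbf x\in \Gamma_{E(3;3;1,1,1)}$ if and only if (1) holds; likewise if and only if (2) holds; likewise if and only if (3) holds, where (each condition including that the denominators involved do not vanish): (1) $\left(\frac{x_2-z_1x_3}{1-x_1z_1},\frac{x_4-z_1x_5}{1-x_1z_1},\frac{x_6-z_1x_7}{1-x_1z_1}\right)\in \Gamma_{E(2;2;1,1)}$ for all $z_1\in\mathbb D$; (2) $\left(\frac{x_1-z_2x_3}{1-x_2z_2},\frac{x_4-z_2x_6}{1-x_2z_2},\frac{x_5-z_2x_7}{1-x_2z_2}\right)\in \Gamma_{E(2;2;1,1)}$ for all $z_2\in\mathbb D$; (3) $\left(\frac{x_1-z_3x_5}{1-x_4z_3},\frac{x_2-z_3x_6}{1-x_4z_3},\frac{x_3-z_3x_7}{1-x_4z_3}\right)\in \Gamma_{E(2;2;1,1)}$ for all $z_3\in\mathbb D$.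
   Context: $\mathbb D$ is the open unit disc. For a linear subspace $E$ of $\mathcal M_{n\times n}(\mathbb C)$, $\mu_E(A)=1/\inf\{\|X\|: X\in E,\ \det(I-AX)=0\}$, with $\mu_E(A)=0$ if $I-AX$ is nonsingular for all $X\in E$ (operator norm). $E(2;2;1,1)$ is the space of $2\times2$ diagonal matrices and $E(3;3;1,1,1)$ the space of $3\times 3$ diagonal matrices. $\Gamma_{E(2;2;1,1)}=\{(a_{11},a_{22},\det A): A\in\mathcal M_{2\times2}(\mathbb C),\ \mu_{E(2;2;1,1)}(A)\le1\}$ (the closed tetrablock). $\Gamma_{E(3;3;1,1,1)}=\{\pi(A): A\in\mathcal M_{3\times3}(\mathbb C),\ \mu_{E(3;3;1,1,1)}(A)\le1\}$ where $$\pi(A)=\big(a_{11},\ a_{22},\ a_{11}a_{22}-a_{12}a_{21},\ a_{33},\ a_{11}a_{33}-a_{13}a_{31},\ a_{22}a_{33}-a_{23}a_{32},\ \det A\big).$$ *)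

(* Defs.v *)
From HB Require Import structures.
From mathcomp Require Import all_boot all_order all_algebra.
From mathcomp Require Import complex.
From mathcomp Require Import boolp classical_sets reals.

Set Implicit Arguments.
Unset Strict Implicit.
Unset Printing Implicit Defensive.

Import Order.TTheory GRing.Theory Num.Theory.

Local Open Scope ring_scope.
Local Open Scope classical_set_scope.
Local Open Scope complex_scope.

Section StructuredSingularValue.
Variable R : realType.

Definition norm2 n (v : 'cV[R[i]]_n) : R :=
  Num.sqrt (\sum_(i < n) Normc.normc (v i 0) ^+ 2).

Definition opnorm n (A : 'M[R[i]]_n) : R :=
  sup [set norm2 (A *m v) | v in [set v : 'cV[R[i]]_n | norm2 v <= 1]].

Definition singularizers n (E : {vspace 'M[R[i]]_n}) (A : 'M[R[i]]_n)
    : set 'M[R[i]]_n :=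
  [set X | X \in E /\ \det (1%:M - A *m X) = 0].

Definition mu n (E : {vspace 'M[R[i]]_n}) (A : 'M[R[i]]_n) : R :=
  if `[< singularizers E A !=set0 >]
  then 1 / inf [set opnorm X | X in singularizers E A]
  else 0.

Definition diagE n : {vspace 'M[R[i]]_n} :=
  limg (linfun (@diag_mx R[i] n)).

Lemma mem_diagE n (X : 'M[R[i]]_n) : (X \in diagE n) = is_diag_mx X.
Proof.
apply/idP/diag_mxP => [/memv_imgP[d _ ->]|[d ->]]; first by exists d; rewrite lfunE.
by rewrite -(lfunE (@diag_mx R[i] n)) memv_img ?memvf.
Qed.

(* Indices are shifted by one: A 0 0 is a_11. *)
Definition pi2 (A : 'M[R[i]]_2) : R[i] * R[i] * R[i] :=
  (A 0 0, A 1 1, \det A).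

Definition pi3 (A : 'M[R[i]]_3)
    : R[i] * R[i] * R[i] * R[i] * R[i] * R[i] * R[i] :=
  (A 0 0,
   A 1 1,
   A 0 0 * A 1 1 - A 0 1 * A 1 0,
   A 2 2,
   A 0 0 * A 2 2 - A 0 2 * A 2 0,
   A 1 1 * A 2 2 - A 1 2 * A 2 1,
   \det A).

Definition Gamma2 : set (R[i] * R[i] * R[i]) :=
  [set pi2 A | A in [set A | mu (diagE 2) A <= 1]].

Definition Gamma3 : set (R[i] * R[i] * R[i] * R[i] * R[i] * R[i] * R[i]) :=
  [set pi3 A | A in [set A | mu (diagE 3) A <= 1]].

End StructuredSingularValue.

(* Main.v *)
(* Membership in either set amounts to non-vanishing of the polynomial
   [\det (1 - A *m diag_mx z)] on the open polydisc, whose coefficients are, up to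
   sign, the coordinates of [pi2 A] or [pi3 A]: this uses that every tuple of
   complex numbers is the tuple of principal minors of some matrix. Freezing one
   variable in the three-variable polynomial and dividing by the constant term
   [1 - x_i z_i] of the result gives the two-variable polynomial at the quotient
   point; that constant term is nonzero as the value at the origin. *)
Require Import Defs.
From HB Require Import structures.
From mathcomp Require Import all_boot all_order all_algebra.
From mathcomp Require Import complex ring.
From mathcomp Require Import boolp classical_sets reals.

Import Order.TTheory GRing.Theory Num.Theory.
Local Open Scope ring_scope.
Local Open Scope classical_set_scope.
Local Open Scope complex_scope.

(** * The operator norm of a diagonal matrix *)

Lemma normc_ge0 (R : realType) (z : R[i]) : 0 <= Normc.normc z.
Proof. by rewrite -lecR (normr_ge0 z). Qed.

(** The norm [|z|] takes values in [R[i]], whereas [norm2] and [opnorm] are built on the real-valued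
    modulus. *)
Lemma normc_lt1 (R : realType) (z : R[i]) : (`|z| < 1) = (Normc.normc z < 1).
Proof. by rewrite -ltcR. Qed.

Section DiagonalNorm.
Variables (R : realType) (n : nat) (d : 'rV[R[i]]_n).

Lemma norm2_diag_mx_le (r : R) (v : 'cV[R[i]]_n) :
    0 <= r -> (forall i, Normc.normc (d 0 i) <= r) -> norm2 v <= 1 ->
  norm2 (diag_mx d *m v) <= r.
Proof.
move=> r0 dr; rewrite /norm2 => v1; set S := \sum_(i < n) _ in v1.
have S0 : 0 <= S by apply: sumr_ge0 => i _; rewrite sqr_ge0.
apply: (@le_trans _ _ (Num.sqrt (r ^+ 2 * S))).
  rewrite ler_wsqrtr// mulr_sumr ler_sum// => i _.
  rewrite mul_diag_mx mxE Normc.normcM exprMn ler_wpM2r ?sqr_ge0//.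
  by rewrite lerXn2r ?nnegrE ?normc_ge0.
by rewrite sqrtrM ?sqr_ge0// sqrtr_sqr ger0_norm// ler_piMr.
Qed.

Lemma opnorm_diag_mx_le (r : R) :
  0 <= r -> (forall i, Normc.normc (d 0 i) <= r) -> opnorm (diag_mx d) <= r.
Proof.
move=> r0 dr; apply: ge_sup => [|_ [v v1 <-]]; last exact: norm2_diag_mx_le.
exists (norm2 (diag_mx d *m 0)), 0 => //=.
rewrite /norm2 big1 ?sqrtr0// => i _.
by rewrite mxE Normc.normc0 expr0n.
Qed.

Lemma normc_le_opnorm_diag_mx (i : 'I_n) :
  Normc.normc (d 0 i) <= opnorm (diag_mx d).
Proof.
have sum_delta (c : R[i]) :
    Num.sqrt (\sum_(k < n) Normc.normc (c * (delta_mx i 0 : 'cV_n) k 0) ^+ 2)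
    = Normc.normc c.
  rewrite (bigD1 i)//= big1 ?addr0 => [|k /negPf ki].
    by rewrite !mxE !eqxx mulr1 sqrtr_sqr ger0_norm ?normc_ge0.
  by rewrite !mxE ki mulr0 Normc.normc0 expr0n.
have norm2_di : norm2 (diag_mx d *m delta_mx i 0) = Normc.normc (d 0 i).
  rewrite -sum_delta /norm2; congr Num.sqrt; apply: eq_bigr => k _.
  rewrite mul_diag_mx !mxE.
  by have [->|] := eqVneq k i; rewrite ?mulr0.
(* A supremum bounds its set only if that set is bounded above; the sum of the moduli of the
   diagonal is a crude bound. *)
rewrite -norm2_di; apply: ub_le_sup.
  exists (\sum_(k < n) Normc.normc (d 0 k)) => _ [v v1 <-].
  apply: norm2_diag_mx_le => // [|k].
    by apply: sumr_ge0 => k _; exact: normc_ge0.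
  rewrite (bigD1 k)//= lerDl sumr_ge0// => j _; exact: normc_ge0.
exists (delta_mx i 0) => //=.
rewrite -[leRHS](@Normc.normc1 R) -(sum_delta 1) /norm2.
by under [in leRHS]eq_bigr do rewrite mul1r.
Qed.

End DiagonalNorm.

(** * The structured singular value for diagonal matrices *)

(* Evaluating [v = v *m A *m diag_mx d] at an entry of [v] of maximal modulus. *)
Lemma singular_diag_mx_lb (R : realType) (n : nat) (A : 'M[R[i]]_n) :
  exists2 c : R, 0 < c & forall d : 'rV[R[i]]_n,
    \det (1%:M - A *m diag_mx d) = 0 -> c <= opnorm (diag_mx d).
Proof.
(* The double sum dominates every column sum of moduli; adding 1 keeps [M] invertible even for
   [A = 0]. *)
pose M : R := 1 + \sum_i \sum_j Normc.normc (A i j).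
have A0 i j : 0 <= Normc.normc (A i j) by exact: normc_ge0.
have M0 : 0 < M by rewrite ltr_pwDl// sumr_ge0// => i _; rewrite sumr_ge0.
exists M^-1 => [|d /eqP/det0P[v v_neq0 vE]]; first by rewrite invr_gt0.
have {}vE j : v 0 j = (v *m A) 0 j * d 0 j.
  move: vE; rewrite mulmxBr mulmx1 mulmxA mul_mx_diag => /eqP.
  by rewrite subr_eq0 => /eqP {1}->; rewrite mxE.
have [i vi0] : exists i, v 0 i != 0.
  apply/existsP; apply: contraNT v_neq0; rewrite negb_exists => /forallP v0.
  by apply/eqP/rowP => i; rewrite mxE; apply/eqP; have := v0 i; rewrite negbK.
case: (@Order.TotalTheory.arg_maxP _ _ _ i xpredT
  (fun j => Normc.normc (v 0 j)) isT) => k _ k_max.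
have vk0 : 0 < Normc.normc (v 0 k).
  apply: lt_le_trans (k_max i isT).
  by rewrite lt_def normc_ge0 andbT; apply: contra_neq vi0 => /Normc.eq0_normc.
have := congr1 (@Normc.normc R) (vE k); rewrite Normc.normcM => vkE.
have vAk : Normc.normc ((v *m A) 0 k) <= Normc.normc (v 0 k) * M.
  rewrite -lecR -[X in X <= _]/(`|(v *m A) 0 k|) mxE.
  apply: le_trans (ler_norm_sum _ _ _) _.
  have -> : \sum_j `|v 0 j * A j k|
      = (\sum_j Normc.normc (v 0 j) * Normc.normc (A j k))%:C.
    by rewrite rmorph_sum; apply: eq_bigr => j _; rewrite -Normc.normcM.
  rewrite lecR mulrDr mulr1 ler_wpDl ?normc_ge0// mulr_sumr ler_sum// => j _.
  rewrite ler_pM ?normc_ge0//; first exact: k_max.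
  by rewrite (bigD1 k)//= lerDl sumr_ge0.
apply: le_trans (normc_le_opnorm_diag_mx _ _ d k).
(* From |v_k| = |(vA)_k| |d_k| <= |v_k| M |d_k|, cancelling |v_k| > 0 leaves 1/M <= |d_k|. *)
rewrite -div1r ler_pdivrMr// -(@ler_pM2l _ (Normc.normc (v 0 k)))// mulr1.
rewrite {1}vkE mulrCA mulrC ler_wpM2l ?normc_ge0//.
Qed.

(** A diagonal matrix has operator norm below 1 exactly when all its entries lie in the open disc,
    so the right-hand side says that every singularizer has norm at least 1. *)
Lemma mu_diagE_le1 (R : realType) (n : nat) (A : 'M[R[i]]_n) :
  mu (diagE R n) A <= 1 <->
  forall d : 'rV[R[i]]_n,
    (forall i, `|d 0 i| < 1) -> \det (1%:M - A *m diag_mx d) != 0.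
Proof.
have [c c0 c_lb] := singular_diag_mx_lb R n A.
have singP X : singularizers (diagE R n) A X ->
    exists2 d, X = diag_mx d & \det (1%:M - A *m diag_mx d) = 0.
  by case; rewrite mem_diagE => /diag_mxP[d ->] ?; exists d.
have lbc : lbound [set opnorm X | X in singularizers (diagE R n) A] c.
  by move=> _ [_ /singP[d -> /c_lb ?] <-].
rewrite /mu; split => [mu1 d d1|det_neq0].
  apply/eqP => detd.
  have dsing : singularizers (diagE R n) A (diag_mx d).
    by split => //; rewrite mem_diagE diag_mx_is_diag.
  move: mu1; rewrite asboolT; last by exists (diag_mx d).
  apply/negP; rewrite -ltNge.
  pose r := \big[Num.max/0]_i Normc.normc (d 0 i).
  have r1 : r < 1.
    by apply: bigmax_lt => // i _; rewrite -normc_lt1.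
  have inf_lt1 : inf [set opnorm X | X in singularizers (diagE R n) A] < 1.
    apply: le_lt_trans r1; apply: (@le_trans _ _ (opnorm (diag_mx d))).
      by apply: ge_inf; [exists c | exists (diag_mx d)].
    apply: opnorm_diag_mx_le => [|i]; first exact: bigmax_ge_id.
    exact: le_bigmax.
  (* The infimum must be positive: as [1 / 0 = 0], a zero infimum would give [mu] the value 0. The
     bound [c] excludes this. *)
  rewrite ltr_pdivlMr ?mul1r//; apply: lt_le_trans c0 _.
  by apply: lb_le_inf => //; exists (opnorm (diag_mx d)), (diag_mx d).
case: asboolP => // -[X Xsing].
have ge1 : 1 <= inf [set opnorm X | X in singularizers (diagE R n) A].
  apply: lb_le_inf; first by exists (opnorm X), X.
  move=> _ [_ /singP[d -> detd] <-]; rewrite leNgt; apply/negP => d1.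
  suff: \det (1%:M - A *m diag_mx d) != 0 by rewrite detd eqxx.
  apply: det_neq0 => i; rewrite normc_lt1.
  exact: le_lt_trans (normc_le_opnorm_diag_mx _ _ _ _) d1.
by rewrite div1r invf_le1// (lt_le_trans _ ge1).
Qed.

(** * Matrices with prescribed principal minors *)

Lemma det_mx22E (R : comNzRingType) (A : 'M[R]_2) :
  \det A = A 0 0 * A 1 1 - A 0 1 * A 1 0.
Proof.
rewrite (expand_det_row _ 0) !big_ord_recl big_ord0 /cofactor !det_mx11 !mxE /=.
have -> : lift 0 0 = 1 :> 'I_2 by exact: val_inj.
have -> : lift 1 0 = 0 :> 'I_2 by exact: val_inj.
by ring.
Qed.
Lemma det_mx33E (R : comNzRingType) (A : 'M[R]_3) :
  \det A = A 0 0 * (A 1 1 * A 2 2 - A 1 2 * A 2 1)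
         - A 0 1 * (A 1 0 * A 2 2 - A 1 2 * A 2 0)
         + A 0 2 * (A 1 0 * A 2 1 - A 1 1 * A 2 0).
Proof.
rewrite (expand_det_row _ 0) !big_ord_recl big_ord0 /cofactor !det_mx22E !mxE /=.
have l00 : lift 0 0 = 1 :> 'I_3 by exact: val_inj.
have l01 : lift 0 1 = 2 :> 'I_3 by exact: val_inj.
have l10 : lift 1 0 = 0 :> 'I_3 by exact: val_inj.
have l11 : lift 1 1 = 2 :> 'I_3 by exact: val_inj.
have l20 : lift 2 0 = 0 :> 'I_3 by exact: val_inj.
have l21 : lift 2 1 = 1 :> 'I_3 by exact: val_inj.
have l0 : lift 0 0 = 1 :> 'I_2 by exact: val_inj.
rewrite !(l0, l00, l01, l10, l11, l20, l21).
by ring.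
Qed.

Lemma pi2_surj (R : realType) (a b p : R[i]) : exists A, pi2 A = (a, b, p).
Proof.
exists (\matrix_(i, j) (nth [::] [:: [:: a; a * b - p]; [:: 1; b]] i)`_j).
by rewrite /pi2 det_mx22E !mxE /=; congr (_, _, _); ring.
Qed.

(** The root (s + e)/2 is taken unless it vanishes, and then the other one; if that vanishes too,
    the sum [s] and the product [q] of the roots are both 0. *)
Lemma quadratic_root_neq0 (F : numClosedFieldType) (s q : F) :
  exists2 u, u ^+ 2 - s * u + q = 0 & u = 0 -> s = 0 /\ q = 0.
Proof.
pose e := sqrtC (s ^+ 2 - 4 * q).
have e2 : e ^+ 2 = s ^+ 2 - 4 * q by rewrite sqrtCK.
have root (t : F) : t ^+ 2 = s ^+ 2 - 4 * q ->
    ((s + t) / 2) ^+ 2 - s * ((s + t) / 2) + q = 0.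
  move=> tE; have -> : ((s + t) / 2) ^+ 2 - s * ((s + t) / 2) + q
    = (t ^+ 2 - (s ^+ 2 - 4 * q)) / 4 by field.
  by rewrite tE subrr mul0r.
have [se|se] := eqVneq (s + e) 0.
  exists ((s - e) / 2); first by apply: root; rewrite sqrrN.
  move=> /(congr1 ( *%R^~ 2)); rewrite mul0r divfK ?pnatr_eq0// => se'.
  have s0 : s = 0.
    have -> : s = ((s + e) + (s - e)) / 2 by field.
    by rewrite se se' addr0 mul0r.
  split=> //; have -> : q = (s ^+ 2 - e ^+ 2) / 4 by rewrite e2; field.
  by move: se; rewrite s0 add0r => ->; rewrite subrr mul0r.
exists ((s + e) / 2); first exact: root.
move=> /(congr1 ( *%R^~ 2)); rewrite mul0r divfK ?pnatr_eq0// => /eqP.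
by rewrite (negPf se).
Qed.

(* With [p], [q], [r] the products [a_12 a_21], [a_13 a_31], [a_23 a_32], the two
   3-cycle products in [\det A] are the roots of [t ^+ 2 - s * t + p * q * r]. *)
Lemma pi3_surj (R : realType) (x1 x2 x3 x4 x5 x6 x7 : R[i]) :
  exists A, pi3 A = (x1, x2, x3, x4, x5, x6, x7).
Proof.
pose p := x1 * x2 - x3; pose q := x1 * x4 - x5; pose r := x2 * x4 - x6.
pose s := x7 - x1 * x2 * x4 + x1 * r + x2 * q + x4 * p.
suff [a12 [a21 [a13 [a31 [a23 [a32 [pE qE rE sE]]]]]]] :
    exists a12 a21 a13 a31 a23 a32, [/\ a12 * a21 = p, a13 * a31 = q,
      a23 * a32 = r & a12 * a23 * a31 + a13 * a32 * a21 = s].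
  exists (\matrix_(i, j)
    (nth [::] [:: [:: x1; a12; a13]; [:: a21; x2; a23]; [:: a31; a32; x4]] i)`_j).
  have x7E : x7 = s + x1 * x2 * x4 - x1 * r - x2 * q - x4 * p.
    by rewrite /s; ring.
  rewrite /pi3 det_mx33E !mxE /=; congr (_, _, _, _, _, _, _).
  - by rewrite pE /p; ring.
  - by rewrite qE /q; ring.
  - by rewrite rE /r; ring.
  - by rewrite x7E -sE -pE -qE -rE; ring.
have [u uE u0] := quadratic_root_neq0 _ s (p * q * r).
have [u_eq0|u_neq0] := eqVneq u 0; last first.
  (* The two 3-cycle products become [u] and pqr/u, which is the other root. *)
  exists 1, p, (q / u), u, 1, r; split; rewrite ?mul1r ?divfK//.
  apply: (mulIf u_neq0); apply/eqP; rewrite -subr_eq0; apply/eqP.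
  by rewrite -uE; field.
(* Now s = 0 and pqr = 0. Zeroing both entries of a pair whose product vanishes kills both 3-cycle
   products, since each contains one entry of every pair. *)
have [-> /eqP] := u0 u_eq0.
rewrite !mulf_eq0 -orbA => /or3P[]/eqP->.
- by exists 0, 0, 1, q, 1, r; split; ring.
- by exists 1, p, 0, 0, 1, r; split; ring.
- by exists 1, p, 1, q, 0, 0; split; ring.
Qed.

(** * Polynomial criteria for membership *)

Lemma Gamma2P (R : realType) (a b p : R[i]) :
  Gamma2 (a, b, p) <->
  forall z w : R[i], `|z| < 1 -> `|w| < 1 -> 1 - a * z - b * w + p * z * w != 0.
Proof.
have detE (A : 'M[R[i]]_2) (d : 'rV_2) : pi2 A = (a, b, p) ->
    \det (1%:M - A *m diag_mx d)
    = 1 - a * d 0 0 - b * d 0 1 + p * d 0 0 * d 0 1.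
  case=> <- <- <-; rewrite mul_mx_diag !det_mx22E !mxE /=; ring.
split=> [[A /mu_diagE_le1 A_ns Api] z w z1 w1|ns].
  have := A_ns (\row_i [:: z; w]`_i); rewrite detE// !mxE; apply.
  by move=> [[|[|//]] i2]; rewrite mxE.
(* The determinant depends on [A] only through [pi2 A], so any preimage serves. *)
have [A Api] := pi2_surj _ a b p.
by exists A => //; apply/mu_diagE_le1 => d d1; rewrite detE// ns.
Qed.

Lemma Gamma3P (R : realType) (x1 x2 x3 x4 x5 x6 x7 : R[i]) :
  Gamma3 (x1, x2, x3, x4, x5, x6, x7) <->
  forall z1 z2 z3 : R[i], `|z1| < 1 -> `|z2| < 1 -> `|z3| < 1 ->
    1 - x1 * z1 - x2 * z2 + x3 * z1 * z2 - x4 * z3 + x5 * z1 * z3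
      + x6 * z2 * z3 - x7 * z1 * z2 * z3 != 0.
Proof.
have detE (A : 'M[R[i]]_3) (d : 'rV_3) :
    pi3 A = (x1, x2, x3, x4, x5, x6, x7) ->
    \det (1%:M - A *m diag_mx d)
    = 1 - x1 * d 0 0 - x2 * d 0 1 + x3 * d 0 0 * d 0 1 - x4 * d 0 2
      + x5 * d 0 0 * d 0 2 + x6 * d 0 1 * d 0 2 - x7 * d 0 0 * d 0 1 * d 0 2.
  case=> <- <- <- <- <- <- <-; rewrite mul_mx_diag !det_mx33E !mxE /=; ring.
split=> [[A /mu_diagE_le1 A_ns Api] z1 z2 z3 z1_lt1 z2_lt1 z3_lt1|ns].
  have := A_ns (\row_i [:: z1; z2; z3]`_i); rewrite detE// !mxE; apply.
  by move=> [[|[|[|//]]] i3]; rewrite mxE.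
have [A Api] := pi3_surj _ x1 x2 x3 x4 x5 x6 x7.
by exists A => //; apply/mu_diagE_le1 => d d1; rewrite detE// ns.
Qed.

(** Clears denominators: the polynomial is [e] times that of the quotient point, and its value at
    the origin is [e]. *)
Lemma Gamma2_fracP (R : realType) (e a b p : R[i]) :
  e != 0 /\ Gamma2 (a / e, b / e, p / e) <->
  forall z w : R[i], `|z| < 1 -> `|w| < 1 -> e - a * z - b * w + p * z * w != 0.
Proof.
have fracE z w : e != 0 ->
    e - a * z - b * w + p * z * w
    = e * (1 - a / e * z - b / e * w + p / e * z * w).
  by move=> e0; field.
split=> [[e0 /Gamma2P ns] z w z1 w1|ns].
  by rewrite fracE// mulf_neq0 ?ns.
have e0 : e != 0.
  by have := ns 0 0; rewrite normr0 !mulr0 !subr0 addr0; apply; exact: ltr01.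
split=> //; apply/Gamma2P => z w z1 w1.
by have := ns z w z1 w1; rewrite fracE// mulf_eq0 negb_or => /andP[].
Qed.

(** * Freezing one of the three variables *)

Theorem theorem2p29 (R : realType) (x1 x2 x3 x4 x5 x6 x7 : R[i]) :
  (Gamma3 (x1, x2, x3, x4, x5, x6, x7) <->
     (forall z1 : R[i], `|z1| < 1 ->
        1 - x1 * z1 != 0 /\
        Gamma2 ((x2 - z1 * x3) / (1 - x1 * z1),
                  (x4 - z1 * x5) / (1 - x1 * z1),
                  (x6 - z1 * x7) / (1 - x1 * z1)))) /\
  (Gamma3 (x1, x2, x3, x4, x5, x6, x7) <->
     (forall z2 : R[i], `|z2| < 1 ->
        1 - x2 * z2 != 0 /\
        Gamma2 ((x1 - z2 * x3) / (1 - x2 * z2),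
                  (x4 - z2 * x6) / (1 - x2 * z2),
                  (x5 - z2 * x7) / (1 - x2 * z2)))) /\
  (Gamma3 (x1, x2, x3, x4, x5, x6, x7) <->
     (forall z3 : R[i], `|z3| < 1 ->
        1 - x4 * z3 != 0 /\
        Gamma2 ((x1 - z3 * x5) / (1 - x4 * z3),
                  (x2 - z3 * x6) / (1 - x4 * z3),
                  (x3 - z3 * x7) / (1 - x4 * z3)))).
Proof.
split; [|split]; rewrite Gamma3P.
(* The polynomial is regrouped as (1 - x1 z1) - (x2 - z1 x3) z2 - (x4 - z1 x5) z3 + (x6 - z1 x7) z2
   z3; the other two cases collect in z2 and z3 likewise. *)
- split=> [ns z1 z1_lt1|frac z1 z2 z3 z1_lt1 z2_lt1 z3_lt1].
    apply/Gamma2_fracP => z w z_lt1 w_lt1.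
    by have := ns _ _ _ z1_lt1 z_lt1 w_lt1; congr (_ != 0); ring.
  have /Gamma2_fracP/(_ _ _ z2_lt1 z3_lt1) := frac _ z1_lt1.
  by congr (_ != 0); ring.
- split=> [ns z2 z2_lt1|frac z1 z2 z3 z1_lt1 z2_lt1 z3_lt1].
    apply/Gamma2_fracP => z w z_lt1 w_lt1.
    by have := ns _ _ _ z_lt1 z2_lt1 w_lt1; congr (_ != 0); ring.
  have /Gamma2_fracP/(_ _ _ z1_lt1 z3_lt1) := frac _ z2_lt1.
  by congr (_ != 0); ring.
- split=> [ns z3 z3_lt1|frac z1 z2 z3 z1_lt1 z2_lt1 z3_lt1].
    apply/Gamma2_fracP => z w z_lt1 w_lt1.
    by have := ns _ _ _ z_lt1 w_lt1 z3_lt1; congr (_ != 0); ring.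
  have /Gamma2_fracP/(_ _ _ z1_lt1 z2_lt1) := frac _ z3_lt1.
  by congr (_ != 0); ring.
Qed.
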